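(* Let $\mathsf{K}$ be a variety of Heyting algebras that has finite depth. Then every $\mathsf{K}$-epimorphism is surjective.
   Context: A Brouwerian algebra is an algebra $\langle A;\to,\wedge,\vee,\top\rangle$ such that $\langle A;\wedge,\vee\rangle$ is a lattice with greatest element $\top$ and $x\wedge y\leqslant z\iff x\leqslant y\to z$. A Heyting algebra is a Brouwerian algebra expanded by a distinguished least element $\bot$ (so homomorphisms preserve $\bot$ and subalgebras contain it). Filters are non-empty lattice filters; a filter is prime if its complement is closed under $\vee$. The depth of a Heyting algebra $A$ is the supremum (in $\omega\cup\{\infty\}$) of the numbers of elements in finite chains, under inclusion, of proper prime filters of $A$ (it is $0$ if $A$ has no proper prime filter). The depth of a variety of Heyting algebras is the supremum of the depths of its members; the variety has finite depth if this supremum is finite. A class $\mathsf{K}$ of similar algebras is regarded as a category whose morphisms are all algebraic homomorphisms between members of $\mathsf{K}$. A $\mathsf{K}$-morphism $h\colon A\to B$ is a $\mathsf{K}$-epimorphism if, for all $\mathsf{K}$-morphisms $f,g$ from $B$ to a single member of $\mathsf{K}$, $f\circ h=g\circ h$ implies $f=g$. *)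

(* Defs.v *)
From HB Require Import structures.
From mathcomp Require Import all_boot all_order.
From mathcomp Require Import boolp classical_sets functions cardinality.

Set Implicit Arguments.
Unset Strict Implicit.
Unset Printing Implicit Defensive.

Import Order.TTheory.
Local Open Scope order_scope.

HB.mixin Record hasImplication d T of Order.TLattice d T := {
  himp : T -> T -> T;
  le_himp : forall x y z : T, (x `&` y <= z) = (x <= himp y z)
}.

#[short(type="brouwerianType")]
HB.structure Definition Brouwerian d :=
  { T of Order.TLattice d T & hasImplication d T }.

#[short(type="heytingType")]
HB.structure Definition Heyting d :=
  { T of Brouwerian d T & Order.hasBottom d T }.

Definition heyting_morphism d (A : heytingType d) d' (B : heytingType d')
    (h : A -> B) : Prop :=
  [/\ {morph h : x y / himp x y >-> himp x y},
      Order.meet_morphism h,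
      Order.join_morphism h,
      h \top = \top
    & h \bot = \bot].

(* Terms in countably many variables in the signature of Heyting algebras. *)
Inductive hterm : Type :=
  | HVar of nat
  | HImp of hterm & hterm
  | HMeet of hterm & hterm
  | HJoin of hterm & hterm
  | HTop
  | HBot.

Fixpoint heval d (A : heytingType d) (v : nat -> A) (t : hterm) : A :=
  match t with
  | HVar n => v n
  | HImp t1 t2 => himp (heval v t1) (heval v t2)
  | HMeet t1 t2 => heval v t1 `&` heval v t2
  | HJoin t1 t2 => heval v t1 `|` heval v t2
  | HTop => \top
  | HBot => \bot
  end.

(* The display [d] is only a printing tag of MathComp orders: a class of
   Heyting algebras ranges over all displays.  A class is not a [set] because
   [set (heytingType d)] would be universe-inconsistent with using [set A] for
   the carriers [A]. *)
Definition heyting_class := forall d, heytingType d -> Prop.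

Definition is_variety (K : heyting_class) : Prop :=
  exists E : set (hterm * hterm), forall d (A : heytingType d),
    K d A <->
    (forall s t, E (s, t) -> forall v : nat -> A, heval v s = heval v t).

Definition is_epi (K : heyting_class) d (A : heytingType d)
    d' (B : heytingType d') (h : A -> B) : Prop :=
  forall d'' (C : heytingType d''), K d'' C ->
  forall f g : B -> C, heyting_morphism f -> heyting_morphism g ->
  f \o h = g \o h -> f = g.

Section Filters.
Context d (L : latticeType d).
Implicit Type F : set L.

Definition lattice_filter F : Prop :=
  [/\ (F !=set0)%classic,
      forall x y, F x -> x <= y -> F y
    & forall x y, F x -> F y -> F (x `&` y)].

(* [F = setT] is allowed here; properness is a separate condition. *)
Definition prime_filter F : Prop :=
  lattice_filter F /\
  forall x y, (~` F)%classic x -> (~` F)%classic y -> (~` F)%classic (x `|` y).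

Definition proper_prime_filters : set (set L) :=
  [set F | prime_filter F /\ F <> setT]%classic.

End Filters.

Arguments proper_prime_filters {d} L _ : rename.

(* The ordered set of natural numbers with a greatest element [None]. *)
Definition enat : Type := option nat.

HB.instance Definition _ := Choice.on enat.

Definition le_enat (m n : enat) : bool :=
  match m, n with
  | _, None => true
  | None, Some _ => false
  | Some i, Some j => (i <= j)%N
  end.

Fact le_enat_refl : reflexive le_enat.
Proof. by case=> //= n; exact: leqnn. Qed.

Fact le_enat_anti : antisymmetric le_enat.
Proof. by move=> [m|] [n|] //= /anti_leq ->. Qed.

Fact le_enat_trans : transitive le_enat.
Proof. by move=> [n|] [m|] [p|] //=; exact: leq_trans. Qed.

Fact enat_display : Order.disp_t. Proof. exact: Order.Disp tt tt. Qed.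

HB.instance Definition _ := Order.Le_isPOrder.Build enat_display enat
  le_enat_refl le_enat_anti le_enat_trans.

Definition enat_sup (S : set enat) : enat := supremum (Some 0%N : enat) S.

Definition depth d (A : heytingType d) : enat :=
  enat_sup [set e | exists (n : nat) (C : set (set A)),
    [/\ (C `<=` proper_prime_filters A)%classic,
        total_on C (fun F G => F `<=` G)%classic,
        (C #= `I_n)%card
      & e = Some n]]%classic.

Definition class_depth (K : heyting_class) : enat :=
  enat_sup [set e | exists d (A : heytingType d), K d A /\ e = depth A]%classic.

Definition has_finite_depth (K : heyting_class) : Prop :=
  exists n : nat, class_depth K = Some n.

(* Main.v *)
Require Import Defs.
From HB Require Import structures.
From mathcomp Require Import all_boot all_order.
From mathcomp Require Import boolp classical_sets functions cardinality.

Set Implicit Arguments.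
Unset Strict Implicit.
Unset Printing Implicit Defensive.

Import Order.TTheory.
Local Open Scope classical_set_scope.
Local Open Scope card_scope.
Local Open Scope order_scope.

(** A non-surjective homomorphism h : A -> B between algebras of finite depth
    is never epic, and this is seen on prime filters.  The map R |-> h^-1(R)
    from primes of B to primes of A is a p-morphism ([prime_lifting]): above
    the preimage of R, every prime of A is the preimage of a prime above R.
    When h misses some b, the filter generated by the values of h above b
    does not contain b, and this produces two distinct primes of B with the
    same preimage ([nonsurjective_glued_primes]).

    Finite depth bounds the chains of primes, so nonempty families of primes
    have maximal members.  Let Q be maximal among the primes sharing their
    preimage with another prime, and P maximal among the other primes in the
    fibre of Q.  Preimages determine the primes strictly above Q, so lifting
    shows that everything strictly above P lies above Q, and that everything
    strictly above Q lies above P ([critical_glued_pair]).  Hence the map of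
    the primes above P which sends P to Q and fixes the rest is again a
    p-morphism.

    By duality it should induce a second homomorphism from B to B/P besides
    the projection.  This requires the map to be continuous, and it is, because
    P is isolated among the primes above it: an element c of Q outside P
    belongs to all the others.  So u |-> [u /\ c] for u outside Q, u |-> top
    for u in Q, is a homomorphism ([collapse_morphism]).  It agrees with the
    projection on the image of h since P and Q have the same preimage, and
    differs from it at c.  As B/P is a quotient of B it belongs to the
    variety ([variety_filter_quotient]), so h is not epic. *)

(** * Finite depth and maximal elements *)

(** Without existence, [supremum] would return a default value and bounding the
    depth would say nothing about chains. *)
Lemma enat_supremums_neq0 (S : set enat) : supremums S !=set0.
Proof.
have [[m Sm]|nofin] := pselect (exists m : nat, ubound S (Some m)).
  have exP : exists m, `[< ubound S (Some m) >] by exists m; apply/asboolP.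
  case: (ex_minnP exP) => k /asboolP ubk mink.
  exists (Some k); split=> // -[j|] // ubj.
  by have /mink : `[< ubound S (Some j) >] by apply/asboolP.
exists None; split; first by case.
by move=> [j|] // ubj; case: nofin; exists j.
Qed.

Lemma enat_sup_ub (S : set enat) e : S e -> e <= enat_sup S.
Proof.
move=> Se; rewrite /enat_sup /supremum; case: ifPn => [/eqP S0|_].
  by move: Se; rewrite S0.
case: xgetP => [y _ [ubS _]|nosup]; first exact: ubS.
by have [y /nosup] := enat_supremums_neq0 S.
Qed.

Lemma finite_depth_chain_bound (K : heyting_class) : has_finite_depth K ->
  exists n : nat, forall d (B : heytingType d), K d B ->
  forall m (C : set (set B)), C `<=` proper_prime_filters B ->
    total_on C (fun F G => F `<=` G) -> C #= `I_m -> (m <= n)%N.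
Proof.
move=> [n Kn]; exists n => d B KB m C CB Ctot Cm.
have mB : (Some m : enat) <= depth B by apply: enat_sup_ub; exists m, C.
have : depth B <= class_depth K by apply: enat_sup_ub; exists d, B.
by rewrite Kn => /(le_trans mB).
Qed.

(** Without a maximal member, repeatedly choosing a strictly larger one would
    give a chain with n + 1 elements. *)
Lemma ex_maximal_bounded_chains T (S : set (set T)) n :
    (forall m (C : set (set T)), C `<=` S ->
      total_on C (fun F G => F `<=` G) -> C #= `I_m -> (m <= n)%N) ->
    S !=set0 ->
  exists P, S P /\ forall R, S R -> P `<=` R -> R = P.
Proof.
move=> bound [P0 SP0]; apply: contrapT => nomax.
have next (P : set T) : exists R, S P -> [/\ S R, P `<=` R & R <> P].
  have [SP|nSP] := pselect (S P); last by exists P => /nSP.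
  apply: contrapT => noR; apply: nomax; exists P; split=> // R SR PR.
  by apply: contrapT => RP; apply: noR; exists R.
have [nxt nxtP] := choice next.
pose f k := iter k nxt P0.
have Sf k : S (f k) by elim: k => //= k /nxtP[].
have fS k : f k `<=` f k.+1 by have [] := nxtP _ (Sf k).
have f_mono j k : (j <= k)%N -> f j `<=` f k.
  move=> /subnK <-; elim: (k - j)%N => // i IH x /IH; exact: fS.
have f_lt j k : (j < k)%N -> f j <> f k.
  move=> jk fjk; have [_ _] := nxtP _ (Sf j); apply.
  apply/seteqP; split; last exact: fS.
  have fSj : f j.+1 `<=` f k by apply: f_mono.
  by rewrite [X in _ `<=` X]fjk.
have f_inj : injective f.
  by move=> j k fjk; case: (ltngtP j k) => // /f_lt; rewrite fjk.
suff : (n.+1 <= n)%N by rewrite ltnn.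
apply: (bound _ (f @` `I_n.+1)).
- by move=> _ [k _ <-].
- move=> _ _ [j _ <-] [k _ <-].
  by case: (leqP j k) => [|/ltnW] /f_mono; [left|right].
- by apply: inj_card_eq => j k _ _; exact: f_inj.
Qed.

(** * Implication in Brouwerian algebras *)

Section HeytingArithmetic.
Context d (B : brouwerianType d).
Implicit Types x y z : B.

Lemma himp_mp x y : himp x y `&` x <= y.
Proof. by rewrite le_himp. Qed.

Lemma himp_top x y : x <= y -> himp x y = \top.
Proof. by move=> xy; apply/eqP; rewrite -le1x -le_himp meet1x. Qed.

(** Yoneda for posets. *)
Lemma le_ext x y : (forall t, (t <= x) = (t <= y)) -> x = y.
Proof. by move=> xy; apply/le_anti; rewrite -xy lexx xy lexx. Qed.

(** The laws [himpI], [himpU], [himp_curry] and [himp_trans] make the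
    relation of [himp x y] belonging to a filter a preorder whose quotient
    is again a Heyting algebra. *)
Lemma himpI z x y : himp z (x `&` y) = himp z x `&` himp z y.
Proof.
by apply: le_ext => t; rewrite lexI -!le_himp lexI.
Qed.

Lemma himpU x y z : himp (x `|` y) z = himp x z `&` himp y z.
Proof.
apply: le_ext => t.
by rewrite lexI -!le_himp ![t `&` _]meetC !le_himp leUx.
Qed.

Lemma himp_curry x y z : himp (x `&` y) z = himp x (himp y z).
Proof.
by apply: le_ext => t; rewrite -!le_himp meetA.
Qed.

Lemma himp_trans x y z : himp x y `&` himp y z <= himp x z.
Proof.
rewrite -le_himp -meetA [himp y z `&` x]meetC meetA.
apply: le_trans (himp_mp y z); rewrite meetC leI2 //; exact: himp_mp.
Qed.
End HeytingArithmetic.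

(** * Prime filters *)

Section Filters.
Context d (B : heytingType d).
Implicit Types (F P R I : set B) (x y : B).

Lemma filter_top F : lattice_filter F -> F \top.
Proof. by case=> -[x Fx] Fle _; exact: Fle Fx (lex1 x). Qed.

Lemma filter_mp F x y : lattice_filter F -> F (himp x y) -> F x -> F y.
Proof. by case=> _ Fle FI Fxy Fx; apply: Fle (FI _ _ Fxy Fx) (himp_mp x y). Qed.

Lemma filter_meetE F x y : lattice_filter F -> F (x `&` y) <-> F x /\ F y.
Proof.
case=> _ Fle FI; split=> [Fxy|[]]; last exact: FI.
by split; [apply: Fle Fxy (leIl _ _)|apply: Fle Fxy (leIr _ _)].
Qed.

Lemma prime_bot P : proper_prime_filters B P -> ~ P \bot.
Proof.
case=> [[[_ Ple _] _] PT] Pbot; apply: PT; apply/seteqP; split=> // x _.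
exact: Ple Pbot (le0x x).
Qed.

Lemma prime_joinE P x y : proper_prime_filters B P ->
  P (x `|` y) <-> P x \/ P y.
Proof.
case=> [[[_ Ple _] Pprime] _]; split=> [Pxy|].
  apply: contrapT => /not_orP[nPx nPy]; exact: Pprime nPx nPy Pxy.
by case=> [Px|Py]; [apply: Ple Px (leUl _ _)|apply: Ple Py (leUr _ _)].
Qed.

Definition filter_adjoin F x : set B :=
  [set z | exists2 y, F y & y `&` x <= z].

Lemma lattice_filter_adjoin F x : lattice_filter F ->
  lattice_filter (filter_adjoin F x).
Proof.
move=> FF; have Ftop := filter_top FF; have [_ _ FI] := FF; split.
- by exists \top; exists \top => //; exact: lex1.
- by move=> y z [t Ft tx] yz; exists t => //; exact: le_trans yz.
- move=> y z [t Ft tx] [u Fu ux]; exists (t `&` u); first exact: FI.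
  rewrite lexI (le_trans _ tx) ?(le_trans _ ux) //; apply: leI2 => //.
    exact: leIr.
  exact: leIl.
Qed.

Lemma sub_filter_adjoin F x : F `<=` filter_adjoin F x.
Proof. by move=> y Fy; exists y => //; exact: leIl. Qed.

Lemma mem_filter_adjoin F x : lattice_filter F -> filter_adjoin F x x.
Proof. by move=> FF; exists \top; [exact: filter_top|exact: leIr]. Qed.

Lemma bigcup_chain_filter (C : set (set B)) : C !=set0 ->
  C `<=` @lattice_filter d B -> total_on C (fun F G => F `<=` G) ->
  lattice_filter (\bigcup_(F in C) F).
Proof.
move=> [F CF] Cfilt Ctot; split.
- by have [[x Fx] _ _] := Cfilt _ CF; exists x, F.
- move=> x y [G CG Gx] xy; exists G => //.
  by have [_ Gle _] := Cfilt _ CG; exact: Gle xy.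
- move=> x y [G CG Gx] [H CH Hy].
  have [GH|HG] := Ctot _ _ CG CH; [exists H|exists G] => //.
    by have [_ _ HI] := Cfilt _ CH; apply: HI => //; exact: GH.
  by have [_ _ GI] := Cfilt _ CG; apply: GI => //; exact: HG.
Qed.

(** A filter maximal among those containing F and disjoint from I is prime: if
    it contains neither x nor y, adjoining either one reaches I, and by
    distributivity so does adjoining x `|` y. *)
Lemma prime_filter_separation F I : lattice_filter F ->
  I !=set0 -> (forall x y, I x -> I y -> I (x `|` y)) ->
  (forall x, F x -> ~ I x) ->
  exists P, [/\ proper_prime_filters B P, F `<=` P & forall x, P x -> ~ I x].
Proof.
move=> FF [i0 Ii0] IU FI0.
(* The empty set is allowed because [Zorn_bigcup] also asks for the union of
   the empty chain. *)
pose good (G : set B) :=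
  G = set0 \/ [/\ lattice_filter G, F `<=` G & forall x, G x -> ~ I x].
have [C Cgood Ctot|M [gM Mmax]] := @Zorn_bigcup _ good.
  have [[G [CG G0]]|noG] := pselect (exists G, C G /\ G !=set0); last first.
    left; apply/seteqP; split=> // x [G CG Gx].
    by apply: noG; exists G; split=> //; exists x.
  right; pose C' := [set H | C H /\ H !=set0].
  have C'good H : C' H ->
      [/\ lattice_filter H, F `<=` H & forall x, H x -> ~ I x].
    by case=> /Cgood[-> [x []]|].
  have -> : \bigcup_(H in C) H = \bigcup_(H in C') H.
    apply/seteqP; split=> x [H]; last by move=> [CH _] Hx; exists H.
    by move=> CH Hx; exists H => //; split=> //; exists x.
  split.
  - apply: bigcup_chain_filter; first by exists G.
      by move=> H /C'good[].
    by move=> H H' [CH _] [CH' _]; exact: Ctot.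
  - by have [_ FG _] := C'good G (conj CG G0); move=> x /FG Gx; exists G.
  - by move=> x [H /C'good[_ _ HI] /HI].
have {gM}[MF FM MI] :
    [/\ lattice_filter M, F `<=` M & forall x, M x -> ~ I x].
  case: gM => // M0; case: (Mmax F); last by right; split.
  rewrite M0; split=> // Fsub; have [[x /Fsub //]] := FF.
have ext x : ~ M x -> exists2 m, M m & exists2 i, I i & m `&` x <= i.
  move=> nMx; apply: contrapT => noI.
  apply: (Mmax (filter_adjoin M x)).
    split; first exact: sub_filter_adjoin.
    by move=> /(_ x (mem_filter_adjoin x MF)).
  right; split; first exact: lattice_filter_adjoin.
    by move=> y /FM; exact: sub_filter_adjoin.
  by move=> y [m Mm mx] Iy; apply: noI; exists m => //; exists y.
exists M; split=> //; split; last by move=> MT; apply: (MI i0) => //; rewrite MT.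
split=> // x y /ext[m Mm [i Ii mi]] /ext[m' Mm' [j Ij mj]] Mxy.
have [_ Mle MM] := MF.
apply: (MI (i `|` j)); last exact: IU.
apply: Mle (MM _ _ (MM _ _ Mm Mm') Mxy) _.
(* distributivity, obtained by moving m `&` m' across the adjunction *)
rewrite meetC le_himp leUx -!le_himp ![_ `&` (m `&` m')]meetC.
apply/andP; split.
  by rewrite (le_trans _ (leUl i j)) // (le_trans _ mi) // leI2 // leIl.
by rewrite (le_trans _ (leUr j i)) // (le_trans _ mj) // leI2 // leIr.
Qed.

Lemma prime_avoiding F x : lattice_filter F -> ~ F x ->
  exists P, [/\ proper_prime_filters B P, F `<=` P & ~ P x].
Proof.
move=> FF nFx; have [|||P [PP FP Px]] := @prime_filter_separation F [set x] FF.
- by exists x.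
- by move=> y z -> ->; rewrite joinxx.
- by move=> y Fy yx; apply: nFx; rewrite -yx.
- by exists P; split=> // /Px; apply.
Qed.

(** The Kripke semantics of implication.  If F omits the implication, the
    filter obtained by adjoining x to F still omits y, and so does some prime
    above it. *)
Lemma filter_himpE F x y : lattice_filter F ->
  F (himp x y) <->
  forall R, proper_prime_filters B R -> F `<=` R -> R x -> R y.
Proof.
move=> FF; split=> [Fxy R [[RF _] _] FR|].
  by apply: filter_mp => //; exact: FR.
move=> Fxy; apply: contrapT => nFxy.
have [||R [RP FR nRy]] := @prime_avoiding (filter_adjoin F x) y.
- exact: lattice_filter_adjoin.
- case=> z Fz zxy; apply: nFxy; have [_ Fle _] := FF.
  by apply: Fle Fz _; rewrite -le_himp.
- apply: nRy; apply: Fxy => //; first by move=> z /(@sub_filter_adjoin F x) /FR.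
  by apply: FR; exact: mem_filter_adjoin.
Qed.

End Filters.

(** * Preimages of prime filters *)

Section Preimages.
Context d (A : heytingType d) d' (B : heytingType d') (h : A -> B)
  (hmorph : heyting_morphism h).

Lemma morph_le x y : x <= y -> h x <= h y.
Proof.
by case: hmorph => _ hI _ _ _ /meet_idPl xy; rewrite -xy hI leIr.
Qed.

Lemma prime_preimage P : proper_prime_filters B P ->
  proper_prime_filters A (h @^-1` P).
Proof.
move=> PP; have [_ hI hU h1 h0] := hmorph; have [[PF _] _] := PP.
have [_ Ple PI] := PF; split; first split; first split.
- by exists \top; rewrite /preimage /= h1; exact: filter_top.
- by move=> x y Px xy; exact: Ple Px (morph_le xy).
- by move=> x y Px Py; rewrite /preimage /= hI; exact: PI.
- move=> x y nPx nPy; rewrite /preimage /= hU.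
  by move=> /(prime_joinE _ _ PP)[].
- move=> PT; apply: (prime_bot PP); rewrite -h0.
  by have : (h @^-1` P) \bot by rewrite PT.
Qed.

(** Preservation of implication makes the preimage map a p-morphism.  Separate
    the filter generated by P and the image of p from the image of the
    complement of p; if x `&` h a <= h b with x in P, a in p and b not in p,
    then P contains h (a -> b), so p contains a -> b, hence b. *)
Lemma prime_lifting P p : proper_prime_filters B P ->
  proper_prime_filters A p -> h @^-1` P `<=` p ->
  exists R, [/\ proper_prime_filters B R, P `<=` R & h @^-1` R = p].
Proof.
move=> PP pp Pp; have [hH hI hU h1 h0] := hmorph; have [[PF _] _] := PP.
have [_ Ple PI] := PF; have [[pF pprime] _] := pp; have [_ ple pI] := pF.
pose F := [set z | exists2 x, P x & exists2 a, p a & x `&` h a <= z].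
have FP : P `<=` F.
  by move=> x Px; exists x => //; exists \top; [exact: filter_top|exact: leIl].
have Fp a : p a -> F (h a).
  by move=> pa; exists \top; [exact: filter_top|exists a => //; exact: leIr].
have [||||R [RP FR Rp]] := @prime_filter_separation _ B F (h @` (~` p)).
- split.
  + by exists (h \top); apply: Fp; exact: filter_top.
  + move=> x y [z Pz [a pa zx]] xy; exists z => //; exists a => //.
    exact: le_trans xy.
  + move=> x y [z Pz [a pa zx]] [t Pt [b pb ty]].
    exists (z `&` t); first exact: PI.
    exists (a `&` b); first exact: pI.
    rewrite hI meetACA lexI (le_trans (leIl _ _) zx).
    exact: le_trans (leIr _ _) ty.
- by exists (h \bot); exists \bot => //; exact: prime_bot.
- move=> _ _ [a pa <-] [b pb <-]; rewrite -hU.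
  by exists (a `|` b) => //; exact: pprime.
- move=> z [x Px [a pa xb]] [b npb hb]; apply: npb.
  apply: filter_mp pF _ pa; apply: Pp; rewrite /preimage /= hH.
  by apply: Ple Px _; rewrite -le_himp hb.
exists R; split=> //; first by move=> x /FP /FR.
apply/seteqP; split=> [a Ra|a /Fp /FR //].
by apply: contrapT => npa; apply: (Rp _ Ra); exists a.
Qed.

(** First choose a prime Q without b containing every value of h above b, then
    a prime P with b whose preimage is included in that of Q.  Lifting moves
    P up until the preimages coincide, without losing b. *)
Lemma nonsurjective_glued_primes b : (forall a, h a <> b) ->
  exists P R, [/\ proper_prime_filters B P, proper_prime_filters B R,
    h @^-1` P = h @^-1` R & P <> R].
Proof.
move=> nhb; have [hH hI hU h1 h0] := hmorph.
pose F0 := [set z | exists2 a, b <= h a & h a <= z].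
have [||Q [QP FQ nQb]] := @prime_avoiding _ B F0 b.
- split.
  + by exists \top; exists \top; rewrite ?h1 ?lex1.
  + by move=> x y [a ba ax] xy; exists a => //; exact: le_trans xy.
  + move=> x y [a ba ax] [a' ba' ay]; exists (a `&` a').
      by rewrite hI lexI ba ba'.
    by rewrite hI leI2.
- by case=> a ba ab; apply: (nhb a); apply/le_anti; rewrite ba ab.
have [[QF Qprime] _] := QP.
have [||||P [PP bP PI]] :=
  @prime_filter_separation _ B [set z | b <= z] (h @` (~` (h @^-1` Q))).
- split; first by exists \top; exact: lex1.
    by move=> x y; exact: le_trans.
  by move=> x y bx byy /=; rewrite lexI bx byy.
- by exists (h \bot); exists \bot => //; rewrite /preimage/= h0; exact: prime_bot.
- move=> _ _ [a Qa <-] [a' Qa' <-]; rewrite -hU; exists (a `|` a') => //.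
  by rewrite /preimage /setC /= hU; exact: Qprime.
- by move=> x bx [a nQa ax]; apply: nQa; apply: FQ; exists a; rewrite // ax.
have [|R [RP PR RQ]] := prime_lifting PP (prime_preimage QP).
  by move=> a Pa; apply: contrapT => nQa; apply: (PI _ Pa); exists a.
exists R, Q; split=> // RQe; apply: nQb; rewrite -RQe.
by apply: PR; apply: bP => /=.
Qed.
End Preimages.

(** * The quotient of a Heyting algebra by a filter *)

Section FilterQuotient.
Context d (B : heytingType d) (F : set B) (FF : lattice_filter F).
Implicit Types x y z t : B.

Let leF x y := F (himp x y).

Fact leF_of_le x y : x <= y -> leF x y.
Proof. by move=> xy; rewrite /leF himp_top //; exact: filter_top. Qed.

Fact leF_trans y x z : leF x y -> leF y z -> leF x z.
Proof.
have [_ Fle FI] := FF.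
by move=> xy yz; apply: Fle (FI _ _ xy yz) (himp_trans x y z).
Qed.

Definition filter_eqv x y := `[< leF x y /\ leF y x >].

Fact filter_eqv_refl : reflexive filter_eqv.
Proof. by move=> x; apply/asboolP; split; exact: leF_of_le. Qed.

Fact filter_eqv_sym : symmetric filter_eqv.
Proof. by move=> x y; apply/asboolP/asboolP => -[]. Qed.

Fact filter_eqv_trans : transitive filter_eqv.
Proof.
move=> y x z /asboolP[xy yx] /asboolP[yz zy]; apply/asboolP.
by split; [apply: leF_trans yz|apply: leF_trans yx].
Qed.

Canonical filter_equiv :=
  EquivRel filter_eqv filter_eqv_refl filter_eqv_sym filter_eqv_trans.

Definition filter_quotient := {eq_quot filter_equiv}%qT.

HB.instance Definition _ : EqQuotient _ filter_equiv filter_quotient :=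
  EqQuotient.on filter_quotient.
HB.instance Definition _ := Choice.on filter_quotient.

Implicit Types a b c : filter_quotient.

Definition filter_pi : B -> filter_quotient := \pi_filter_quotient%qT.

Fact repr_eqv x : leF (repr (filter_pi x)) x /\ leF x (repr (filter_pi x)).
Proof.
have : filter_eqv (repr (filter_pi x)) x.
  by apply/(@eqquotP _ filter_equiv filter_quotient); rewrite reprK.
by move/asboolP.
Qed.

Definition quotient_le a b := `[< leF (repr a) (repr b) >].

Fact quotient_le_pi x y : quotient_le (filter_pi x) (filter_pi y) <-> leF x y.
Proof.
have [xr rx] := repr_eqv x; have [yr ry] := repr_eqv y.
split=> [/asboolP xy|xy].
  exact: leF_trans rx (leF_trans xy yr).
by apply/asboolP; exact: leF_trans xr (leF_trans xy ry).
Qed.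

Fact quotient_le_refl : reflexive quotient_le.
Proof. by move=> a; apply/asboolP; exact: leF_of_le. Qed.

Fact quotient_le_anti : antisymmetric quotient_le.
Proof.
move=> a b /andP[/asboolP ab /asboolP ba]; rewrite -[a]reprK -[b]reprK.
by apply/eqquotP/asboolP.
Qed.

Fact quotient_le_trans : transitive quotient_le.
Proof. by move=> b a c /asboolP ab /asboolP bc; apply/asboolP/(leF_trans ab). Qed.

HB.instance Definition _ := Order.Le_isPOrder.Build d filter_quotient
  quotient_le_refl quotient_le_anti quotient_le_trans.

Lemma le_filter_pi x y : (filter_pi x <= filter_pi y) = `[< F (himp x y) >].
Proof. by apply/idP/asboolP => /quotient_le_pi. Qed.

Fact filter_piW (P : filter_quotient -> Prop) :
  (forall x, P (filter_pi x)) -> forall a, P a.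
Proof. by move=> Ppi a; rewrite -[a]reprK; exact: Ppi. Qed.

Definition quotient_op (op : B -> B -> B) a b := filter_pi (op (repr a) (repr b)).

Fact quotient_meetP a b c :
  (a <= quotient_op Order.meet b c) = (a <= b) && (a <= c).
Proof.
elim/filter_piW: a => x; rewrite -[b in RHS]reprK -[c in RHS]reprK.
rewrite !le_filter_pi himpI -asbool_and.
by apply: asbool_equiv_eq; exact: filter_meetE.
Qed.

Fact quotient_joinP a b c :
  (quotient_op Order.join a b <= c) = (a <= c) && (b <= c).
Proof.
elim/filter_piW: c => x; rewrite -[a in RHS]reprK -[b in RHS]reprK.
rewrite !le_filter_pi himpU -asbool_and.
by apply: asbool_equiv_eq; exact: filter_meetE.
Qed.

HB.instance Definition _ := Order.POrder_MeetJoin_isLattice.Build d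
  filter_quotient quotient_meetP quotient_joinP.

Fact quotient_lex1 a : a <= filter_pi \top.
Proof.
by elim/filter_piW: a => x; rewrite le_filter_pi; apply/asboolP/leF_of_le/lex1.
Qed.

Fact quotient_le0x a : filter_pi \bot <= a.
Proof.
by elim/filter_piW: a => x; rewrite le_filter_pi; apply/asboolP/leF_of_le/le0x.
Qed.

HB.instance Definition _ := Order.hasTop.Build d filter_quotient quotient_lex1.

HB.instance Definition _ :=
  Order.hasBottom.Build d filter_quotient quotient_le0x.

Fact quotient_le_himp a b c :
  (a `&` b <= c) = (a <= quotient_op (@himp d B) b c).
Proof.
rewrite -[a in RHS]reprK -[c in LHS]reprK !le_filter_pi.
by rewrite himp_curry.
Qed.

HB.instance Definition _ := hasImplication.Build d filter_quotient
  quotient_le_himp.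

(** A filter is the intersection of the primes above it, so equality modulo F
    can be tested on these primes. *)
Lemma filter_pi_eq x y :
  (forall R, proper_prime_filters B R -> F `<=` R -> (R x <-> R y)) ->
  filter_pi x = filter_pi y.
Proof.
move=> xy; apply/le_anti; rewrite !le_filter_pi.
by apply/andP; split; apply/asboolP/(filter_himpE _ _ FF) => R PR FR;
  have [] := xy R PR FR.
Qed.

Lemma filter_pi_morphism : heyting_morphism filter_pi.
Proof.
have piI : {morph filter_pi : x y / x `&` y}.
  move=> x y; apply: le_ext; elim/filter_piW => z.
  by rewrite lexI !le_filter_pi himpI -asbool_and;
    apply: asbool_equiv_eq; exact: filter_meetE.
split=> //.
- move=> x y; apply: le_ext; elim/filter_piW => z.
  by rewrite -le_himp -piI !le_filter_pi himp_curry.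
- have piU x y c :
      (filter_pi (x `|` y) <= c) = (filter_pi x <= c) && (filter_pi y <= c).
    elim/filter_piW: c => z; rewrite !le_filter_pi himpU -asbool_and.
    by apply: asbool_equiv_eq; exact: filter_meetE.
  move=> x y; apply/le_anti; rewrite piU leUl leUr /=.
  by rewrite leUx -piU.
Qed.

End FilterQuotient.

Lemma heval_morph d (A : heytingType d) d' (B : heytingType d') (h : A -> B)
    (v : nat -> A) t :
  heyting_morphism h -> heval (h \o v) t = h (heval v t).
Proof.
case=> hH hI hU h1 h0.
by elim: t => //= [s -> t ->|s -> t ->|s -> t ->]; rewrite ?hH ?hI ?hU.
Qed.

(** A valuation in the quotient lifts along the projection, so equations of B
    remain valid. *)
Lemma variety_filter_quotient (K : heyting_class) d (B : heytingType d)
    (F : set B) (FF : lattice_filter F) :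
  is_variety K -> K d B -> K d (filter_quotient FF).
Proof.
move=> [E KE] /KE BE; apply/KE => s t /BE Est v.
have -> : v = filter_pi FF \o (repr \o v).
  by apply/funext => n; rewrite /= /filter_pi reprK.
by rewrite !(heval_morph _ _ (filter_pi_morphism FF)) Est.
Qed.

(** Whether a prime contains an implication depends on the primes above it, so
    implications are transferred by the forth and back conditions of a
    p-morphism s.  The condition relating g to s stands in for continuity:
    the inverse image under s of the set of primes containing x is
    represented by an element. *)
Lemma spectral_map_morphism d (B : heytingType d) (F : set B)
    (FF : lattice_filter F) (s : set B -> set B) (g : B -> B) :
  (forall R, proper_prime_filters B R -> F `<=` R ->
    proper_prime_filters B (s R)) ->
  (forall R T, proper_prime_filters B R -> proper_prime_filters B T ->
    F `<=` R -> R `<=` T -> s R `<=` s T) ->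
  (forall R T, proper_prime_filters B R -> proper_prime_filters B T ->
    F `<=` R -> s R `<=` T ->
    exists R', [/\ proper_prime_filters B R', R `<=` R' & s R' = T]) ->
  (forall R x, proper_prime_filters B R -> F `<=` R -> R (g x) <-> s R x) ->
  heyting_morphism (filter_pi FF \o g).
Proof.
move=> sP smono sback sg.
have [piH piI piU pi1 pi0] := filter_pi_morphism FF.
have filt R : proper_prime_filters B R -> lattice_filter R by case=> [[]].
split=> [x y|x y|x y||] /=; rewrite -?piH -?piI -?piU -?pi1 -?pi0;
  apply: filter_pi_eq => R RP FR; have RF := filt _ RP;
  have sRP := sP _ RP FR; have sRF := filt _ sRP.
- rewrite sg // filter_himpE // filter_himpE //; split=> sRxy T TP.
    move=> RT; have FT := subset_trans FR RT.
    by rewrite !sg //; apply: sRxy; [exact: sP|exact: smono].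
  move=> sRT; have [T' [T'P RT' <-]] := sback _ _ RP TP FR sRT.
  have FT' := subset_trans FR RT'.
  by rewrite -!sg //; exact: sRxy.
- by rewrite sg // !filter_meetE // !sg.
- by rewrite sg // !prime_joinE // !sg.
- by rewrite sg //; split=> _; exact: filter_top.
- by rewrite sg //; split=> [/(prime_bot sRP)|/(prime_bot RP)].
Qed.

(** * Collapsing a critical pair of prime filters *)

(** Take Q maximal among the primes sharing their preimage with another prime,
    and P maximal among the other primes in the fibre of Q.  A prime
    strictly above Q is therefore alone in its fibre, which forces the lifts
    used to compare what lies above P with what lies above Q.  Maximality of
    Q also prevents Q from being strictly below P. *)
Lemma critical_glued_pair d (A : heytingType d) d' (B : heytingType d')
    (h : A -> B) (n : nat) :
  heyting_morphism h ->
  (forall m (C : set (set B)), C `<=` proper_prime_filters B ->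
    total_on C (fun F G => F `<=` G) -> C #= `I_m -> (m <= n)%N) ->
  (exists b, forall a, h a <> b) ->
  exists P Q,
    [/\ proper_prime_filters B P /\ proper_prime_filters B Q,
        h @^-1` P = h @^-1` Q,
        ~ Q `<=` P,
        forall R, proper_prime_filters B R -> P `<=` R -> R <> P -> Q `<=` R
      & forall R, proper_prime_filters B R -> Q `<=` R -> R <> Q -> P `<=` R].
Proof.
move=> hmorph chains [b nhb].
have maximal (S : set (set B)) : S `<=` proper_prime_filters B -> S !=set0 ->
    exists P, S P /\ forall R, S R -> P `<=` R -> R = P.
  move=> SB; apply: (@ex_maximal_bounded_chains B S n) => m C CS.
  by apply: chains => //; exact: subset_trans SB.
pose glued P R := [/\ proper_prime_filters B R, h @^-1` R = h @^-1` P & R <> P].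
have [||Q [[QP [P0 QP0]] Qmax]] := maximal
    [set P | proper_prime_filters B P /\ exists R, glued P R].
- by move=> P [].
- by have [P [R [PP RP PR nPR]]] := nonsurjective_glued_primes hmorph nhb;
    exists R; split=> //; exists P.
have [||P [[PP PQ nPQ] Pmax]] := maximal [set P | glued Q P].
- by move=> P [].
- by exists P0.
have aboveQ R T : proper_prime_filters B R -> proper_prime_filters B T ->
    Q `<=` R -> R <> Q -> h @^-1` T = h @^-1` R -> T = R.
  move=> RP TP QR nRQ TR; apply: contrapT => nTR; apply: nRQ.
  by apply: Qmax => //; split=> //; exists T.
have upP R : proper_prime_filters B R -> P `<=` R -> R <> P -> Q `<=` R.
  move=> RP PR nRP.
  have [|T [TP QT TR]] := prime_lifting hmorph QP (prime_preimage hmorph RP).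
    by rewrite -PQ; move=> a; exact: PR.
  have [TQ|nTQ] := pselect (T = Q).
    have [->//|nRQ] := pselect (R = Q).
    by case: nRP; apply: Pmax => //; split=> //; rewrite -TR TQ.
  by rewrite (aboveQ T R).
have upQ R : proper_prime_filters B R -> Q `<=` R -> R <> Q -> P `<=` R.
  move=> RP QR nRQ.
  have [|T [TP PT TR]] := prime_lifting hmorph PP (prime_preimage hmorph RP).
    by rewrite PQ; move=> a; exact: QR.
  by rewrite -(aboveQ R T).
exists P, Q; split=> // QP'.
apply: (nPQ); apply: Qmax => //.
by split=> //; exists Q; split=> //; exact: nesym.
Qed.

Section Collapse.
Context d (B : heytingType d) (P Q : set B) (c : B).

(** The map on elements dual to sending P to Q and fixing the other primes
    above P. *)
Definition collapse x : B := if `[< Q x >] then \top else x `&` c.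

(** A prime strictly above P contains Q, hence c, and so contains
    [collapse x] exactly when it contains x; P itself omits c, and so
    contains [collapse x] exactly when x is in Q. *)
Lemma collapse_morphism (PF : lattice_filter P) :
  proper_prime_filters B P -> proper_prime_filters B Q -> Q c -> ~ P c ->
  (forall R, proper_prime_filters B R -> P `<=` R -> R <> P -> Q `<=` R) ->
  (forall R, proper_prime_filters B R -> Q `<=` R -> R <> Q -> P `<=` R) ->
  heyting_morphism (filter_pi PF \o collapse).
Proof.
move=> PP QP Qc nPc upP upQ; have [[QF _] _] := QP.
pose s R := if `[< R = P >] then Q else R.
have sP : s P = Q by rewrite /s; case: asboolP.
have sN R : R <> P -> s R = R by rewrite /s; case: asboolP.
apply: (@spectral_map_morphism _ _ _ _ s).
- by move=> R RP _; have [->|/sN ->] := pselect (R = P); rewrite ?sP.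
- move=> R T RP TP PR RT; have [TeP|nTP] := pselect (T = P).
    have -> : R = P by apply/seteqP; split=> //; rewrite -TeP.
    by rewrite TeP.
  rewrite (sN T) //; have [->|nRP] := pselect (R = P).
    by rewrite sP; apply: upP => //; exact: subset_trans RT.
  by rewrite sN.
- move=> R T RP TP PR; have [->|nRP] := pselect (R = P).
    rewrite sP => QT; have [->|nTQ] := pselect (T = Q).
      by exists P; split.
    exists T; split=> //; first exact: upQ.
    by apply: sN => TeP; apply: nPc; rewrite -TeP; exact: QT.
  rewrite sN // => RT; exists T; split=> //.
  by apply: sN => TeP; apply: nRP; apply/seteqP; split=> //; rewrite -TeP.
- move=> R x RP PR; have [[RF _] _] := RP; rewrite /collapse.
  have [->|nRP] := pselect (R = P).
    rewrite sP; case: asboolP => Qx; first by split=> _ //; exact: filter_top.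
    by split=> // /(filter_meetE _ _ PF)[].
  have QR := upP R RP PR nRP; rewrite sN //; case: asboolP => Qx.
    by split=> _; [exact: QR|exact: filter_top].
  by rewrite filter_meetE //; split=> [[]|Rx] //; split=> //; exact: QR.
Qed.

End Collapse.

Theorem theorem5p3 (K : heyting_class) (Kvar : is_variety K)
    (Kdepth : has_finite_depth K)
    (d : Order.disp_t) (A : heytingType d) (KA : K d A)
    (d' : Order.disp_t) (B : heytingType d') (KB : K d' B)
    (h : A -> B) (hmorph : heyting_morphism h) (hepi : is_epi K h) :
  forall b : B, exists a : A, h a = b.
Proof.
move=> b; apply: contrapT => /forallNP nhb.
have [n chains] := finite_depth_chain_bound Kdepth.
have [|P [Q [[PP QP] PQ nQP upP upQ]]] :=
  critical_glued_pair hmorph (chains _ B KB).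
  by exists b.
have [c Qc nPc] : exists2 c, Q c & ~ P c.
  apply: contrapT => noc; apply: nQP => x Qx.
  by apply: contrapT => nPx; apply: noc; exists x.
have [[PF _] _] := PP; have [[QF _] _] := QP.
have fg : filter_pi PF = filter_pi PF \o collapse Q c.
  apply: hepi; [exact: variety_filter_quotient|exact: filter_pi_morphism| |].
    exact: collapse_morphism.
  apply/funext => a /=; apply: filter_pi_eq => R RP PR.
  have [[RF _] _] := RP.
  have PQa : P (h a) <-> Q (h a).
    by have := congr1 (fun S : set A => S a) PQ; rewrite /preimage /= => ->.
  rewrite /collapse; case: asboolP => Qa.
    by split=> _; [exact: filter_top|apply: PR; exact/PQa].
  (* outside P, h a lies only in primes strictly above P, which contain c *)
  rewrite filter_meetE //; split=> [Ra|[]//]; split=> //.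
  apply: (upP R) Qc => // RP'; apply: Qa; apply/PQa; by rewrite -RP'.
have : filter_pi PF \top <= filter_pi PF c.
  rewrite [in X in _ <= X]fg /= /collapse; case: asboolP => //.
rewrite le_filter_pi => /asboolP Pc; apply: nPc.
exact: filter_mp PF Pc (filter_top PF).
Qed.
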